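(* Let $a>0$, let $k\ge 1$ and $k_b\in\mathbb{N}$, let $\lambda>0$, let $r,p\ge 1$ be integers, and let $a_{-r},\dots,a_p$ be real numbers with $a_{-r}\,a_p\neq0$ satisfying $$\forall\, m=0,\dots,k,\quad \sum_{\ell=-r}^p \ell^m a_\ell=(-\lambda a)^m,\qquad\text{and}\qquad \sup_{\theta\in[0,2\pi]}\Big|\sum_{\ell=-r}^p a_\ell\, e^{i\ell\theta}\Big|\le 1 .$$ Then there exists a constant $C>0$ such that for all initial data $(f_j)_{j\le J}\in\ell^2$ and for all boundary source terms $(g_{J+1}^n)_{n\ge0},\dots,(g_{J+p}^n)_{n\ge0}$ verifying the growth condition $$\forall\,\Gamma>0,\quad \sum_{n\ge0}e^{-2\Gamma n}\Big((g_{J+1}^n)^2+\cdots+(g_{J+p}^n)^2\Big)<+\infty,$$ the solution $(u_j^n)_{j\le J+p,\,n\in\mathbb{N}}$ to the scheme $$\begin{cases} u_j^0=f_j, & j\le J,\\ (D_-^{k_b}u^n)_{J+\ell}=g_{J+\ell}^n, & n\in\mathbb{N},\ \ell=1,\dots,p,\\ u_j^{n+1}=\displaystyle\sum_{\ell=-r}^p a_\ell\,u_{j+\ell}^n, & n\in\mathbb{N},\ j\le J, \end{cases}$$ satisfies the estimate $$\sup_{n\in\mathbb{N}}\Big(e^{-2\gamma n\Delta t}\sum_{j\le J}\Delta x\,(u_j^n)^2\Big)+\sum_{n\ge0}\Delta t\,e^{-2\gamma n\Delta t}\sum_{\ell=1-r-k_b}^{p}(u_{J+\ell}^n)^2\le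 C\left\{\sum_{j\le J}\Delta x\,(f_j)^2+\sum_{n\ge0}\Delta t\,e^{-2\gamma n\Delta t}\sum_{\ell=1}^p(g_{J+\ell}^n)^2\right\}$$ for any $\gamma>0$, and for any $\Delta t$ and $\Delta x$ such that $\Delta t/\Delta x=\lambda$ and $\Delta t\in(0,1]$. In particular, the numerical boundary conditions of this scheme satisfy the Uniform Kreiss Lopatinskii Condition.
   Context: $\mathbb{N}=\{0,1,2,\dots\}$. $J\in\mathbb{N}^*=\mathbb{N}\setminus\{0\}$ is arbitrary; the grid index $j$ runs over the integers $j\le J$ (interior) and $J+1,\dots,J+p$ (ghost cells). $D_-$ is the backward difference operator $(D_-v)_j=v_j-v_{j-1}$ acting on sequences $(v_j)_{j\le J+p}$, $D_-^m$ its $m$-th iterate, $D_-^0$ the identity. At each time level the ghost values $u_{J+1}^n,\dots,u_{J+p}^n$ are determined successively from the boundary conditions. The constant $C$ depends only on $a,\lambda,k,k_b,r,p$ and the coefficients $a_\ell$ (not on $J,\Delta x,\Delta t,\gamma,f,g$). Uniform Kreiss Lopatinskii Condition (for this scheme): for every $R\ge2$ there is a constant $C_R>0$ such that for every $z\in\mathbb{C}$ with $1<|z|\le R$ and every square-summable complex sequence $(w_j)_{j\le J+p}$ satisfying $z\,w_j=\sum_{\ell=-r}^p a_\ell\,w_{j+\ell}$ for all $j\le J$, one has $\sum_{\ell=1-r}^{p}|w_{J+\ell}|^2\le C_R\sum_{\ell=1}^p|(D_-^{k_b}w)_{J+\ell}|^2$. *)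

(* Defs.v *)
From HB Require Import structures.
From mathcomp Require Import all_boot all_order all_algebra.
From mathcomp Require Import all_classical all_reals all_analysis.
From mathcomp Require Import complex.
Import Order.TTheory GRing.Theory Num.Theory.

Set Implicit Arguments.
Unset Strict Implicit.
Unset Printing Implicit Defensive.

Local Open Scope classical_set_scope.
Local Open Scope ring_scope.
Local Open Scope complex_scope.

(* The integers m, m + 1, ..., n in increasing order; empty when n < m. *)
Definition zrange (m n : int) : seq int :=
  if m <= n then [seq m + i%:Z | i <- iota 0 `|n - m|%N.+1] else [::].

(* Grid functions are indexed by all of int, but only the indices j <= J + p
   are meaningful: nothing below reads a value to the right of J + p. *)
Definition Dminus (V : zmodType) (v : int -> V) : int -> V :=
  fun j => v j - v (j - 1).

Section Scheme.
Variables (R : realType) (r p : nat) (a : int -> R).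

Definition cmod (z : R[i]) : R := ComplexField.Normc.normc z.

Definition expi (t : R) : R[i] := cos t +i* sin t.

(* a, with arguments restricted to [-r, p], is the stencil of the scheme;
   vel is the velocity, lam = dt / dx. Here 0 ^+ 0 = 1. *)
Definition consistent (vel lam : R) (k : nat) : Prop :=
  forall m : nat, (m <= k)%N ->
    \sum_(l <- zrange (- r%:Z) p%:Z) l%:~R ^+ m * a l = (- (lam * vel)) ^+ m.

Definition l2_stable : Prop :=
  (ereal_sup [set (cmod (\sum_(l <- zrange (- r%:Z) p%:Z)
                           (a l)%:C * expi (l%:~R * theta)))%:E
             | theta in [set t : R | (0 <= t <= 2 * pi)%R]] <= 1%:E)%E.

Definition square_summable (J : int) (f : int -> R) : Prop :=
  (\esum_(j in [set j : int | (j <= J)%R]) ((f j) ^+ 2)%:E < +oo)%E.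

Definition square_summableC (J : int) (w : int -> R[i]) : Prop :=
  (\esum_(j in [set j : int | (j <= J)%R]) ((cmod (w j)) ^+ 2)%:E < +oo)%E.

Definition growth_condition (J : int) (g : nat -> int -> R) : Prop :=
  forall Gam : R, 0 < Gam ->
    (\sum_(0 <= n <oo)
       (expR (- (2 * Gam * n%:R)) *
        \sum_(l <- zrange 1 p%:Z) (g n (J + l)) ^+ 2)%:E < +oo)%E.

Definition is_solution (kb : nat) (J : int) (f : int -> R)
    (g : nat -> int -> R) (u : nat -> int -> R) : Prop :=
  [/\ forall j : int, j <= J -> u 0%N j = f j,
      forall (n : nat) (l : int), 1 <= l <= p%:Z ->
        iter kb (@Dminus R) (u n) (J + l) = g n (J + l)
    & forall (n : nat) (j : int), j <= J ->
        u n.+1 j = \sum_(l <- zrange (- r%:Z) p%:Z) a l * u n (j + l)].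

Definition interior_term (J : int) (gam dt dx : R) (u : nat -> int -> R)
    : \bar R :=
  ereal_sup (range (fun n : nat =>
    ((expR (- (2 * gam * n%:R * dt)))%:E *
     \esum_(j in [set j : int | (j <= J)%R]) (dx * (u n j) ^+ 2)%:E)%E)).

Definition trace_term (kb : nat) (J : int) (gam dt : R) (u : nat -> int -> R)
    : \bar R :=
  (\sum_(0 <= n <oo)
     (dt * expR (- (2 * gam * n%:R * dt)) *
      \sum_(l <- zrange (1 - r%:Z - kb%:Z) p%:Z) (u n (J + l)) ^+ 2)%:E)%E.

Definition initial_term (J : int) (dx : R) (f : int -> R) : \bar R :=
  (\esum_(j in [set j : int | (j <= J)%R]) (dx * (f j) ^+ 2)%:E)%E.

Definition source_term (J : int) (gam dt : R) (g : nat -> int -> R) : \bar R :=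
  (\sum_(0 <= n <oo)
     (dt * expR (- (2 * gam * n%:R * dt)) *
      \sum_(l <- zrange 1 p%:Z) (g n (J + l)) ^+ 2)%:E)%E.

(* Uniform Kreiss Lopatinskii Condition. The constant is uniform in J; by
   translation invariance this is the same as asking it for a single J. *)
Definition UKLC (kb : nat) : Prop :=
  forall rho : R, 2 <= rho ->
  exists2 C : R, 0 < C &
  forall J : nat, (0 < J)%N ->
  forall z : R[i], 1 < cmod z <= rho ->
  forall w : int -> R[i],
    square_summableC (J%:Z + p%:Z) w ->
    (forall j : int, j <= J%:Z ->
       z * w j = \sum_(l <- zrange (- r%:Z) p%:Z) (a l)%:C * w (j + l)) ->
    \sum_(l <- zrange (1 - r%:Z) p%:Z) (cmod (w (J%:Z + l))) ^+ 2 <=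
    C * \sum_(l <- zrange 1 p%:Z)
          (cmod (iter kb (@Dminus R[i]) w (J%:Z + l))) ^+ 2.

End Scheme.

(* Main.v *)
Require Import Defs.
From HB Require Import structures.
From mathcomp Require Import all_boot all_order all_algebra.
From mathcomp Require Import all_classical all_reals all_analysis.
From mathcomp Require Import complex ring lra zify.
Import Order.TTheory GRing.Theory Num.Theory.

(** The scheme is read from the boundary inwards: with [v i] the value at the
    cell [J + p - i] and [b h = a_(p - h)], it becomes
    [v^(n+1) (p + i) = \sum_(h <= d) b h * v^n (i + h)] with [d = p + r], so that
    the ghost cells are the indices [i < p] and no index is negative.

    Stability on the whole line says that the stencil does not increase the
    sum of squares of any sequence. This is applied at each time step to
    extensions of [v] to the right of the last ghost cell, and what the
    extension loses there controls the traces.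

    - Extension by zero ([dirichlet_dissipation]): beyond the boundary the
      stencil returns a triangular system in the [d] last values of [v], whose
      diagonal is [a_(-r) <> 0]. All traces are thus dissipated, and the only
      energy brought in is that of the ghost values: this is the case
      [kb = 0].

    - Extension by a slowly decreasing multiple of the last value [v 0]
      ([outflow_dissipation]): by consistency at orders 0 and 1 the flux of a
      constant state is [lam * vel * (v 0)^2 > 0], since the transport leaves
      the domain. Hence [v 0] is controlled by the increments of [v] near the
      boundary.

    The differences of a solution solve the same scheme with boundary
    conditions of order one less, so the second estimate gives an induction on
    [kb] ([energy_estimate]). The result is an estimate up to any finite time,
    without exponential weights and with a constant independent of that time.
    It involves only finite windows of cells, because a window shrinks by [r]
    cells at each step and the initial window is arbitrary.

    Summation by parts in time inserts the decreasing weights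
    [exp (- 2 gam n dt)] and yields the stability estimate. Applying the finite
    time estimate to the real and imaginary parts of [z^n * w] and averaging
    over a long time, which makes the initial energy negligible, yields the
    Uniform Kreiss Lopatinskii Condition. *)

Set Implicit Arguments.
Unset Strict Implicit.
Unset Printing Implicit Defensive.

Local Open Scope ring_scope.
Local Open Scope complex_scope.

(** * Sums of squares *)

Lemma sum_sqr_ge0 (R : realDomainType) (m : nat) (x : nat -> R) :
  0 <= \sum_(i < m) x i ^+ 2.
Proof. by apply: sumr_ge0 => i _; exact: sqr_ge0. Qed.

Lemma cauchy_schwarz_sum (R : realFieldType) (m : nat) (c x : nat -> R) :
  (\sum_(i < m) c i * x i) ^+ 2
    <= (\sum_(i < m) c i ^+ 2) * (\sum_(i < m) x i ^+ 2).
Proof.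
set A := \sum_(i < m) c i ^+ 2; set P := \sum_(i < m) c i * x i.
set B := \sum_(i < m) x i ^+ 2.
have key t : 0 <= A * t ^+ 2 - 2 * P * t + B.
  have -> : A * t ^+ 2 - 2 * P * t + B = \sum_(i < m) (c i * t - x i) ^+ 2.
    rewrite /A /P /B mulr_suml mulr_sumr mulr_suml -sumrB -big_split /=.
    by apply: eq_bigr => i _; ring.
  exact: (sum_sqr_ge0 m (fun i => c i * t - x i)).
have A0 : 0 <= A by exact: sum_sqr_ge0.
have [A_eq0|A_neq0] := eqVneq A 0.
  have -> : P = 0.
    rewrite /P big1 // => i _.
    have := psumr_eq0P (fun i _ => sqr_ge0 (c (i : 'I_m))) A_eq0 (i:=i) isT.
    by move/eqP; rewrite sqrf_eq0 => /eqP ->; rewrite mul0r.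
  by rewrite A_eq0 mul0r expr0n.
have := key (P / A); rewrite -(ler_pM2r (x := A)) ?lt_neqAle ?A0 ?[0 == A]eq_sym ?A_neq0 //.
rewrite mul0r => h; rewrite -subr_ge0; apply: le_trans h _.
by rewrite le_eqVlt; apply/predU1P; left; field.
Qed.

Lemma sqrD_le (R : realDomainType) (x y : R) :
  (x + y) ^+ 2 <= 2 * x ^+ 2 + 2 * y ^+ 2.
Proof.
have h := sqr_ge0 (x - y); rewrite -subr_ge0; apply: le_trans h _.
by rewrite le_eqVlt; apply/predU1P; left; ring.
Qed.

(** * Stencils and boundary dissipation *)

Definition stencil (R : pzRingType) (d : nat) (b x : nat -> R) (i : nat) : R :=
  \sum_(h < d.+1) b h * x (i + h)%N.

(** Contraction of the sum of squares over the whole line, stated on windows so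
    that sequences need not be summable: the output window only sees [d] more
    input entries. *)
Definition window_contractive (R : realFieldType) (d : nat) (b : nat -> R) : Prop :=
  forall (M : nat) (x : nat -> R),
    \sum_(i < M) stencil d b x i ^+ 2 <= \sum_(i < M + d) x i ^+ 2.

(** Since indices increase away from the boundary, this is the backward
    difference on the grid. *)
Definition bdiff (V : zmodType) (v : nat -> V) (i : nat) : V := v i - v i.+1.

(** A triangular convolution can be inverted by forward substitution, each new
    entry being bounded by the previous ones. *)
Lemma triangular_coercive (R : realFieldType) (c : nat -> R) (m : nat) :
  c 0%N != 0 ->
  exists2 C : R, 0 < C & forall v : nat -> R,
    \sum_(i < m) v i ^+ 2
      <= C * \sum_(i < m) (\sum_(t < i.+1) c (i - t)%N * v t) ^+ 2.
Proof.
move=> c0; elim: m => [|m [C C0 IH]].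
  by exists 1 => // v; rewrite !big_ord0 mulr0.
set K := \sum_(t < m) c (m - t)%N ^+ 2.
have K0 : 0 <= K by exact: (sum_sqr_ge0 m (fun t => c (m - t)%N)).
have ic : 0 < (c 0%N ^+ 2)^-1 by rewrite invr_gt0 exprn_even_gt0.
set e := (c 0%N ^+ 2)^-1 in ic.
exists (C + 2 * e * (1 + K * C)).
  have : 0 <= e * (K * C) by rewrite !mulr_ge0 // ltW.
  by lra.
move=> v; rewrite !big_ord_recr /= subnn.
set Y := \sum_(i < m) (\sum_(t < i.+1) _) ^+ 2.
set P := \sum_(t < m) c (m - t)%N * v t.
have Pb : P ^+ 2 <= K * (C * Y).
  apply: le_trans (cauchy_schwarz_sum m (fun t => c (m - t)%N) v) _.
  by rewrite ler_wpM2l.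
have vm : v m ^+ 2 <= e * (2 * (P + c 0%N * v m) ^+ 2 + 2 * P ^+ 2).
  have -> : v m ^+ 2 = e * ((P + c 0%N * v m) + - P) ^+ 2.
    by rewrite /e; field.
  rewrite ler_wpM2l ?(ltW ic) //.
  by have := sqrD_le (P + c 0%N * v m) (- P); rewrite sqrrN.
have e1 : e * P ^+ 2 <= e * (K * (C * Y)) by rewrite ler_wpM2l // ltW.
have Y0 : 0 <= Y by exact: (sum_sqr_ge0 m (fun i => \sum_(t < i.+1) c (i - t)%N * v t)).
have z0 := sqr_ge0 (P + c 0%N * v m).
set Z := (P + _) ^+ 2 in vm z0 *.
have z1 : 0 <= (C + 2 * e * (K * C)) * Z.
  by rewrite mulr_ge0 // addr_ge0 ?mulr_ge0 // ltW.
have z2 : 0 <= e * Y by rewrite mulr_ge0 // ltW.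
apply: (le_trans (lerD (IH v) vm)).
rewrite -subr_ge0.
have -> : (C + 2 * e * (1 + K * C)) * (Y + Z) - (C * Y + e * (2 * Z + 2 * P ^+ 2))
 = (C + 2 * e * (K * C)) * Z + 2 * (e * Y) + 2 * (e * (K * (C * Y)) - e * P ^+ 2) by ring.
lra.
Qed.

(** Put [d] zeros before [v]: the contraction property still bounds the outputs
    at these [d] positions, and they form a triangular system in
    [v 0, ..., v d.-1] with diagonal coefficient [b d]. *)
Lemma dirichlet_dissipation (R : realFieldType) (d : nat) (b : nat -> R) :
  window_contractive d b -> b d != 0 ->
  exists2 c : R, 0 < c & forall (M : nat) (v : nat -> R),
    \sum_(i < M) stencil d b v i ^+ 2 + c * \sum_(i < d) v i ^+ 2
      <= \sum_(i < M + d) v i ^+ 2.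
Proof.
move=> ctr bd.
have bd0 : b (d - 0)%N != 0 by rewrite subn0.
(* [c s = b (d - s)] is the coefficient met at distance [s] from the diagonal. *)
have [C C0 HC] := triangular_coercive (c := fun s => b (d - s)%N) d bd0.
exists C^-1; first by rewrite invr_gt0.
move=> M v; set x := fun i => if (i < d)%N then 0 else v (i - d)%N.
have := ctr (d + M)%N x; rewrite -addnA [leLHS]big_split_ord [leRHS]big_split_ord /=.
rewrite [X in _ <= X + _]big1; last by move=> i _; rewrite /x ltn_ord expr0n.
rewrite add0r.
have xv i : x (d + i)%N = v i by rewrite /x ltnNge leq_addr addKn.
under [X in _ <= X]eq_bigr do rewrite xv.
have -> : \sum_(i < M) stencil d b x (d + i) ^+ 2
        = \sum_(i < M) stencil d b v i ^+ 2.
  by apply: eq_bigr => i _; congr (_ ^+ 2); apply: eq_bigr => h _; rewrite -addnA xv.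
move=> h; apply: (le_trans _ h); rewrite [leLHS]addrC lerD2r ler_pdivrMl //.
apply: le_trans (HC v) _; rewrite ler_pM2l //.
apply: ler_sum => i _; rewrite le_eqVlt; apply/predU1P; left; congr (_ ^+ 2); apply: esym.
(* Only the last [i.+1] coefficients of the stencil reach past the zeros. *)
have di : d.+1 = ((d - i) + i.+1)%N by rewrite addnS subnK // ltnW.
rewrite /stencil -(big_mkord xpredT (fun h => b h * x (i + h)%N)) di /=.
rewrite (big_cat_nat (n := (d - i)%N)) ?leq_addr //=.
rewrite big_nat big1 ?add0r; last first.
  move=> h1 /andP[_ hd]; rewrite /x.
  by rewrite -ltn_subRL hd mulr0.
rewrite -{1}[(d - i)%N]add0n big_addn addKn big_mkord.
apply: eq_bigr => t _.
have ti : (t <= i)%N by rewrite -ltnS.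
have -> : (t + (d - i) = d - (i - t))%N.
  by rewrite subnBA // addnC addnBAC ?subnK // ltnW.
have -> : (i + (d - (i - t)) = d + t)%N.
  rewrite subnBA // addnBA; first by rewrite addnC addnK.
  by rewrite (leq_trans (ltnW (ltn_ord i))) ?leq_addr.
by rewrite xv.
Qed.

(** The energy flux of the constant state 1, computed on a profile [chi] that
    rises linearly from 0 to 1 over a long distance [L]. From
    [2 y (x - y) = x^2 - y^2 - (x - y)^2] with [x = chi (i + h)] and
    [y = chi (i + p)], the differences of squares telescope to [h - p], which
    [b] averages to [al], while the squares of the increments sum to
    [O(1 / L)]. *)
Lemma slow_cutoff (R : archiRealFieldType) (d p : nat) (b : nat -> R) (al : R) :
  (p <= d)%N -> 0 < al ->
  \sum_(h < d.+1) b h = 1 ->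
  \sum_(h < d.+1) b h * ((h : nat)%:R - p%:R) = al ->
  exists (S : nat) (chi : nat -> R),
    (forall i, (S <= i)%N -> chi i = 1) /\
    \sum_(i < S) chi i ^+ 2 + p%:R + al / 2
      <= \sum_(i < S) stencil d b chi i ^+ 2.
Proof.
move=> pd al0 b1 bal.
set A := \sum_(h < d.+1) `|b h|.
have A0 : 0 <= A by apply: sumr_ge0.
(* [Q <= L] makes the total error [(d + L) * A * (d / L)^2] at most [al / 2]. *)
pose Q : R := 4 * A * d%:R ^+ 2 / al.
have Q0 : 0 <= Q by rewrite divr_ge0 ?mulr_ge0 ?exprn_ge0 // ltW.
pose L := (d + (Num.bound Q).+1)%N.
have L0 : 0 < L%:R :> R by rewrite ltr0n /L addnS.
have LQ : Q <= L%:R.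
  apply: (le_trans (ltW (archi_boundP Q0))).
  by rewrite ler_nat /L addnS -addSn leq_addl.
have dL : d%:R <= L%:R :> R by rewrite ler_nat leq_addr.
pose chi i : R := (minn (i - d) L)%:R / L%:R.
have chi_lo i : (i <= d)%N -> chi i = 0.
  by rewrite /chi -subn_eq0 => /eqP ->; rewrite min0n mul0r.
have chi_hi i : (d + L <= i)%N -> chi i = 1.
  move=> h; rewrite /chi (minn_idPr _) ?divff ?lt0r_neq0 //.
  by rewrite leq_subRL // (leq_trans _ h) // leq_addr.
exists (d + L)%N, chi; split => //.
have lip i h : (h <= d)%N -> (chi (i + h)%N - chi (i + p)%N) ^+ 2 <= (d%:R / L%:R) ^+ 2.
  move=> hd; rewrite /chi -mulrBl !exprMn ler_pM2r ?exprn_gt0 ?invr_gt0 //.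
  set m1 := minn _ _; set m2 := minn _ _.
  have h1 : (m1 <= m2 + d)%N by rewrite /m1 /m2; lia.
  have h2 : (m2 <= m1 + d)%N by rewrite /m1 /m2; lia.
  rewrite -[leLHS]real_normK ?num_real // ler_sqr ?nnegrE ?ler0n // ler_norml.
  move: h1 h2; rewrite -!(ler_nat R) !natrD; lra.
have tele h : (h <= d)%N ->
    \sum_(i < d + L) chi (i + h)%N ^+ 2 = \sum_(i < d + L) chi i ^+ 2 + h%:R.
  elim: h => [|h IH] hd.
    by rewrite addr0; apply: eq_bigr => i _; rewrite addn0.
  have e : \sum_(i < (d + L).+1) chi (i + h)%N ^+ 2
         = \sum_(i < (d + L).+1) chi (i + h)%N ^+ 2 by [].
  rewrite [LHS]big_ord_recl [RHS]big_ord_recr /= IH 1?ltnW // in e.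
  rewrite add0n chi_lo 1?ltnW // chi_hi ?leq_addr // expr0n add0r expr1n in e.
  rewrite -natr1 addrA -e; apply: eq_bigr => i _.
  by rewrite /bump /= add1n addnS addSn.
(* The pointwise inequality drops the square [(stencil - y)^2]. *)
have low i : chi (i + p)%N ^+ 2
    + \sum_(h < d.+1) b h * (chi (i + h)%N ^+ 2 - chi (i + p)%N ^+ 2)
    - A * (d%:R / L%:R) ^+ 2 <= stencil d b chi i ^+ 2.
  set y := chi (i + p)%N.
  have e : 2 * y * (stencil d b chi i - y)
     = \sum_(h < d.+1) b h * (chi (i + h)%N ^+ 2 - y ^+ 2)
       - \sum_(h < d.+1) b h * (chi (i + h)%N - y) ^+ 2.
    have -> : stencil d b chi i - y = \sum_(h < d.+1) b h * (chi (i + h)%N - y).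
      under [RHS]eq_bigr do rewrite mulrBr.
      by rewrite sumrB -mulr_suml b1 mul1r.
    rewrite mulr_sumr -sumrB; apply: eq_bigr => h _; ring.
  have f : \sum_(h < d.+1) b h * (chi (i + h)%N - y) ^+ 2 <= A * (d%:R / L%:R) ^+ 2.
    rewrite /A mulr_suml; apply: ler_sum => h _.
    apply: (@le_trans _ _ (`|b h| * (chi (i + h)%N - y) ^+ 2)).
      by rewrite ler_wpM2r ?sqr_ge0 // ler_norm.
    by rewrite ler_wpM2l // lip // -ltnS.
  have g := sqr_ge0 (stencil d b chi i - y).
  have -> : stencil d b chi i ^+ 2
     = y ^+ 2 + 2 * y * (stencil d b chi i - y) + (stencil d b chi i - y) ^+ 2 by ring.
  by rewrite e; lra.
apply: le_trans (ler_sum _ (fun i _ => low (i : 'I_(d + L)))).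
rewrite !big_split /= tele // exchange_big /=.
have -> : \sum_(h < d.+1) \sum_(i < d + L)
    b h * (chi (i + h)%N ^+ 2 - chi (i + p)%N ^+ 2) = al.
  rewrite -bal; apply: eq_bigr => h _.
  rewrite -mulr_sumr sumrB !tele // -1?ltnS //; ring.
rewrite sumr_const card_ord mulNrn -[_ *+ (d + L)]mulr_natl.
suff : (d + L)%:R * (A * (d%:R / L%:R) ^+ 2) <= al / 2 by lra.
apply: (@le_trans _ _ (2 * L%:R * (A * (d%:R / L%:R) ^+ 2))).
  by rewrite ler_wpM2r ?(mulr_ge0 A0) ?sqr_ge0 // (natrD _ d L); lra.
have -> : 2 * L%:R * (A * (d%:R / L%:R) ^+ 2) = (Q / L%:R) * (al / 2).
  by rewrite /Q; field; rewrite !lt0r_neq0.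
rewrite ler_piMl //; first by rewrite divr_ge0 // ltW.
by rewrite ler_pdivrMr // mul1r.
Qed.

(** Telescoping and Cauchy-Schwarz. *)
Lemma sum_diff_sqr_le (R : realFieldType) (d : nat) (v : nat -> R) (t : nat) :
  (t <= d)%N -> (v t - v 0%N) ^+ 2 <= d%:R * \sum_(i < d) bdiff v i ^+ 2.
Proof.
move=> td.
have -> : v t - v 0%N = - \sum_(i < t) 1 * bdiff v i.
  elim: t {td} => [|t IH]; first by rewrite big_ord0 subrr oppr0.
  by rewrite big_ord_recr /= opprD -IH mul1r /bdiff; ring.
rewrite sqrrN; apply: le_trans (cauchy_schwarz_sum t (fun=> 1) (bdiff v)) _.
under eq_bigr do rewrite expr1n.
rewrite sumr_const card_ord ler_pM ?sum_sqr_ge0 ?ler0n ?ler_nat //.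
rewrite -(subnK td) addnC big_split_ord /= lerDl.
by apply: sumr_ge0 => i _; exact: sqr_ge0.
Qed.

(** Extend [v] by [v 0 * chi]. If [v] were constant, [slow_cutoff] would give
    a gain [al / 2 * v 0 ^+ 2] on top of the energy of the [p] ghost
    cells. The deviation of [v] from [v 0] adds terms that are linear in [v 0]
    and in the increments, absorbed by half of this gain, and terms that are
    quadratic in the increments. *)
Lemma outflow_dissipation (R : archiRealFieldType) (d p : nat) (b : nat -> R) (al : R) :
  window_contractive d b -> (p <= d)%N -> 0 < al ->
  \sum_(h < d.+1) b h = 1 ->
  \sum_(h < d.+1) b h * ((h : nat)%:R - p%:R) = al ->
  exists2 C : R, 0 < C & forall (M : nat) (v : nat -> R),
    \sum_(i < M) stencil d b v i ^+ 2 + \sum_(i < p) v i ^+ 2 + al / 4 * v 0%N ^+ 2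
      <= \sum_(i < M + d) v i ^+ 2 + C * \sum_(i < d) bdiff v i ^+ 2.
Proof.
move=> ctr pd al0 b1 bal.
have [S [chi [chi1 flux]]] := slow_cutoff pd al0 b1 bal.
set beta := stencil d b chi in flux.
pose B2 := \sum_(h < d.+1) b h ^+ 2.
pose W2 := \sum_(i < S) beta i ^+ 2.
have B20 : 0 <= B2 by exact: (sum_sqr_ge0 d.+1 b).
have W20 : 0 <= W2 by exact: sum_sqr_ge0.
(* [K1] and [K2] are the Cauchy-Schwarz constants of the two linear forms in
   the increments that multiply [v 0]: [Y1] comes from the ghost cells and [Y2]
   from the outputs beyond the boundary. *)
pose K1 : R := p%:R * (p%:R * d%:R).
pose K2 : R := W2 * (S%:R * (B2 * (d.+1%:R * d%:R))).
have K10 : 0 <= K1 by rewrite !mulr_ge0.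
have K20 : 0 <= K2 by rewrite !mulr_ge0.
exists (4 / al * (2 * K1 + 2 * K2) + p%:R * d%:R + 1).
  have F0 : 0 <= 4 / al by rewrite divr_ge0 // ltW.
  by rewrite ltr_pwDr // !addr_ge0 ?(mulr_ge0 F0) ?addr_ge0 ?mulr_ge0.
move=> M v; set D := \sum_(i < d) bdiff v i ^+ 2.
have D0 : 0 <= D by exact: sum_sqr_ge0.
set s := v 0%N; pose e i := v (i - S)%N - s.
pose x i := s * chi i + e i.
have xv i : x (S + i)%N = v i.
  by rewrite /x /e chi1 ?leq_addr // addKn mulr1 subrKC.
have xs (i : 'I_S) : x i = s * chi i.
  rewrite /x /e; have /eqP -> : (i - S == 0)%N by rewrite subn_eq0 ltnW.
  by rewrite subrr addr0.
have e2 i : (i <= S + d)%N -> e i ^+ 2 <= d%:R * D.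
  by move=> h; apply: sum_diff_sqr_le; rewrite leq_subLR.
have := ctr (S + M)%N x; rewrite -addnA [leLHS]big_split_ord [leRHS]big_split_ord /=.
under [X in _ <= _ + X]eq_bigr do rewrite xv.
have -> : \sum_(i < M) stencil d b x (S + i) ^+ 2
        = \sum_(i < M) stencil d b v i ^+ 2.
  by apply: eq_bigr => i _; congr (_ ^+ 2); apply: eq_bigr => h _; rewrite -addnA xv.
have -> : \sum_(i < S) x i ^+ 2 = s ^+ 2 * \sum_(i < S) chi i ^+ 2.
  by rewrite mulr_sumr; apply: eq_bigr => i _; rewrite xs exprMn.
pose Y2 := \sum_(i < S) beta i * stencil d b e i.
(* Dropping the square of the stencil of [e] only loses a nonnegative term. *)
have lowS : s ^+ 2 * W2 + 2 * s * Y2 <= \sum_(i < S) stencil d b x i ^+ 2.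
  rewrite /W2 /Y2 !mulr_sumr -big_split; apply: ler_sum => i _ /=.
  have -> : stencil d b x i = s * beta i + stencil d b e i.
    rewrite /beta /stencil mulr_sumr -big_split; apply: eq_bigr => h _ /=.
    by rewrite /x; ring.
  have := sqr_ge0 (stencil d b e i); rewrite -subr_ge0 => h.
  rewrite -subr_ge0; apply: le_trans h _; rewrite le_eqVlt; apply/predU1P; left; ring.
pose Y1 := \sum_(i < p) 1 * e (S + i)%N.
have sump : \sum_(i < p) v i ^+ 2 <= p%:R * s ^+ 2 + 2 * s * Y1 + p%:R * d%:R * D.
  have -> : \sum_(i < p) v i ^+ 2
      = p%:R * s ^+ 2 + 2 * s * Y1 + \sum_(i < p) e (S + i)%N ^+ 2.
    rewrite /Y1 mulr_sumr [p%:R * _]mulr_natl -[p in _ *+ p]card_ord.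
    rewrite -sumr_const -!big_split; apply: eq_bigr => i _ /=.
    by rewrite /e addKn; ring.
  rewrite lerD2l -mulrA [leRHS]mulr_natl -[p in leRHS]card_ord -sumr_const.
  apply: ler_sum => i _; apply: e2; rewrite leq_add2l.
  exact: leq_trans (ltnW (ltn_ord i)) pd.
have Y1b : Y1 ^+ 2 <= K1 * D.
  apply: (le_trans (cauchy_schwarz_sum p (fun=> 1) (fun i => e (S + i)%N))).
  under eq_bigr do rewrite expr1n.
  rewrite sumr_const card_ord /K1 -!mulrA ler_wpM2l //.
  rewrite [leRHS]mulr_natl -[p in leRHS]card_ord -sumr_const.
  apply: ler_sum => i _; apply: e2; rewrite leq_add2l.
  exact: leq_trans (ltnW (ltn_ord i)) pd.
have Y2b : Y2 ^+ 2 <= K2 * D.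
  apply: (le_trans (cauchy_schwarz_sum S beta (stencil d b e))).
  rewrite /K2 -!mulrA ler_wpM2l //.
  rewrite [leRHS]mulr_natl -[S in leRHS]card_ord -sumr_const.
  apply: ler_sum => i _.
  apply: (le_trans (cauchy_schwarz_sum d.+1 b (fun h => e (i + h)%N))).
  rewrite ler_wpM2l // [leRHS]mulr_natl -[d.+1 in leRHS]card_ord -sumr_const.
  apply: ler_sum => h _; apply: e2.
  by rewrite leq_add // ?(ltnW (ltn_ord i)) // -ltnS.
(* Half of the gain [al / 2 * s ^+ 2] is spent here, the rest is kept. *)
have absorb : 2 * s * (Y1 - Y2) <= al / 4 * s ^+ 2 + 4 / al * (Y1 - Y2) ^+ 2.
  have h := sqr_ge0 (al * s - 4 * (Y1 - Y2)).
  have h' : 0 <= (4 * al)^-1 * (al * s - 4 * (Y1 - Y2)) ^+ 2.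
    by rewrite mulr_ge0 // invr_ge0 mulr_ge0 // ltW.
  rewrite -subr_ge0; apply: le_trans h' _.
  rewrite le_eqVlt; apply/predU1P; left; field.
  by rewrite lt0r_neq0.
have Y12 : (Y1 - Y2) ^+ 2 <= (2 * K1 + 2 * K2) * D.
  have := sqrD_le Y1 (- Y2); rewrite sqrrN; lra.
have Y12' : 4 / al * (Y1 - Y2) ^+ 2 <= 4 / al * ((2 * K1 + 2 * K2) * D).
  by rewrite ler_wpM2l // divr_ge0 // ltW.
have flux' : 0 <= s ^+ 2 * (W2 - (\sum_(i < S) chi i ^+ 2 + p%:R + al / 2)).
  by rewrite mulr_ge0 ?sqr_ge0 // subr_ge0.
move=> ctr'.
set E1 := \sum_(i < M) _ in ctr' *; set E0 := \sum_(i < M + d) _ in ctr' *.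
set X := \sum_(i < S) chi i ^+ 2 in ctr' flux'.
set Z := \sum_(i < S) stencil d b x i ^+ 2 in ctr' lowS.
move: ctr' lowS sump absorb Y12' flux' D0.
set s2 := s ^+ 2; set P := \sum_(i < p) _.
rewrite !mulrDl !mulrDr !mulrN; set F := 4 / al.
lra.
Qed.

(** * The estimate in finite time *)

Definition solves (R : pzRingType) (d p : nat) (b : nat -> R) (v : nat -> nat -> R) : Prop :=
  forall n i, v n.+1 (p + i)%N = stencil d b (v n) i.

(** [B] stands for the energy of the initial data, and [M] for the width of
    the window in which the final energy is measured. *)
Definition finite_time_estimate (R : realFieldType) (d p q : nat) (b : nat -> R) (C : R) : Prop :=
  forall (v : nat -> nat -> R) (B : R),
    solves d p b v ->
    (forall M, \sum_(i < M) v 0%N (p + i)%N ^+ 2 <= B) ->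
    forall N M,
      \sum_(i < M) v N (p + i)%N ^+ 2 + \sum_(n < N) \sum_(i < d + q) v n i ^+ 2
      <= C * (B + \sum_(n < N) \sum_(i < p) iter q (@bdiff R) (v n) i ^+ 2).

(** Each step is allowed to look at a window wider by [r] cells: going back to
    time 0 the window becomes wider and wider, which is harmless because the
    initial bound is uniform in the window. *)
Lemma dissipation_iter (R : realFieldType) (E : nat -> nat -> R) (A G : nat -> R)
    (r : nat) (B : R) :
  (forall M, E 0%N M <= B) ->
  (forall n M, E n.+1 M + A n <= E n (M + r)%N + G n) ->
  forall N M, E N M + \sum_(n < N) A n <= B + \sum_(n < N) G n.
Proof.
move=> E0 step; elim=> [|N IH] M; first by rewrite !big_ord0 !addr0.
by rewrite !big_ord_recr /=; have := step N M; have := IH (M + r)%N; lra.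
Qed.

Lemma solves_diff (R : pzRingType) (d p : nat) (b : nat -> R) v :
  solves d p b v -> solves d p b (fun n => bdiff (v n)).
Proof.
move=> sol n i; rewrite /bdiff -addnS !sol -sumrB.
by apply: eq_bigr => h _; rewrite addSn mulrBr.
Qed.

Lemma energy_diff_le (R : realFieldType) (p : nat) (f : nat -> R) (B : R) :
  (forall M, \sum_(i < M) f (p + i)%N ^+ 2 <= B) ->
  forall M, \sum_(i < M) bdiff f (p + i)%N ^+ 2 <= 4 * B.
Proof.
move=> fB M.
apply: (@le_trans _ _ (\sum_(i < M) (2 * f (p + i)%N ^+ 2 + 2 * f (p + i.+1)%N ^+ 2))).
  apply: ler_sum => i _; rewrite addnS.
  by have := sqrD_le (f (p + i)%N) (- f (p + i).+1); rewrite sqrrN.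
rewrite big_split /= -!mulr_sumr.
have := fB M.+1; rewrite big_ord_recl /= => h2.
have h1 := fB M; have h0 := sqr_ge0 (f (p + 0)%N).
by under [X in _ + 2 * X]eq_bigr do rewrite -[_.+1]/(bump 0 _); lra.
Qed.

(** Induction on the order [q] of the boundary condition. The increments of
    [v] satisfy the estimate of order [q] with the same boundary data; they
    control [v 0] through [outflow_dissipation], and then all the traces of
    [v] by summation of the increments from the boundary. *)
Theorem energy_estimate (R : archiRealFieldType) (d p : nat) (b : nat -> R) (al : R) :
  window_contractive d b -> b d != 0 -> (p <= d)%N -> 0 < al ->
  \sum_(h < d.+1) b h = 1 ->
  \sum_(h < d.+1) b h * ((h : nat)%:R - p%:R) = al ->
  forall q : nat, exists2 C : R, 0 < C & finite_time_estimate d p q b C.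
Proof.
move=> ctr bd pd al0 b1 bal; elim=> [|q [Cq Cq0 IH]].
  have [c c0 Hc] := dirichlet_dissipation ctr bd.
  exists (1 + c^-1); first by rewrite addr_gt0 ?invr_gt0.
  move=> v B sol vB N M; rewrite addn0 /=.
  have := @dissipation_iter R (fun n M => \sum_(i < M) v n (p + i)%N ^+ 2)
    (fun n => c * \sum_(i < d) v n i ^+ 2) (fun n => \sum_(i < p) v n i ^+ 2)
    (d - p) B vB.
  have step n K : \sum_(i < K) v n.+1 (p + i)%N ^+ 2 + c * \sum_(i < d) v n i ^+ 2
      <= \sum_(i < K + (d - p)) v n (p + i)%N ^+ 2 + \sum_(i < p) v n i ^+ 2.
    under [X in X + _ <= _]eq_bigr do rewrite sol.
    have := Hc K (v n).
    have -> : (K + d = p + (K + (d - p)))%N by rewrite addnCA subnKC.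
    by rewrite [X in _ <= X -> _]big_split_ord [X in _ <= X -> _]addrC.
  move=> /(_ step N M); rewrite -mulr_sumr.
  set E := \sum_(i < M) _; set T := \sum_(n < N) _; set Q := B + _ => h.
  have E0 : 0 <= E by apply: sumr_ge0 => i _; exact: sqr_ge0.
  have T0 : 0 <= T by apply: sumr_ge0 => n _; apply: sumr_ge0 => i _; exact: sqr_ge0.
  have cT0 : 0 <= c * T by rewrite mulr_ge0 // ltW.
  have TQ : T <= c^-1 * Q by rewrite ler_pdivlMl //; lra.
  by rewrite mulrDl mul1r; apply: lerD => //; lra.
have [K K0 HK] := outflow_dissipation ctr pd al0 b1 bal.
pose m : R := (d + q.+1)%:R.
pose c1 : R := 1 + m * (8 / al).
pose c2 : R := m * (2 * (d + q)%:R).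
have c10 : 1 <= c1 by rewrite lerDl mulr_ge0 // divr_ge0 // ltW.
have c20 : 0 <= c2 by rewrite !mulr_ge0.
have c3 : 0 <= (c1 * K + c2) * Cq.
  by rewrite mulr_ge0 ?addr_ge0 ?mulr_ge0 ?(ltW Cq0) ?(ltW K0) // (le_trans _ c10).
exists (c1 + 4 * ((c1 * K + c2) * Cq)); first by lra.
move=> v B sol vB N M.
have B0 : 0 <= B by have := vB 0%N; rewrite big_ord0.
set G := \sum_(n < N) \sum_(i < p) _.
have G0 : 0 <= G by apply: sumr_ge0 => n _; apply: sumr_ge0 => i _; exact: sqr_ge0.
pose Wn n := \sum_(i < d + q) bdiff (v n) i ^+ 2.
set W := \sum_(n < N) Wn n.
have Wb : W <= Cq * (4 * B + G).
  have := IH _ _ (solves_diff sol) (energy_diff_le vB) N 0%N.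
  rewrite big_ord0 add0r => /le_trans; apply; rewrite /G le_eqVlt.
  apply/predU1P; left; congr (_ * (_ + _)).
  by apply: eq_bigr => n _; apply: eq_bigr => i _; rewrite iterSr.
have := @dissipation_iter R (fun n M => \sum_(i < M) v n (p + i)%N ^+ 2)
    (fun n => al / 4 * v n 0%N ^+ 2) (fun n => K * Wn n) (d - p) B vB.
have step n L : \sum_(i < L) v n.+1 (p + i)%N ^+ 2 + al / 4 * v n 0%N ^+ 2
      <= \sum_(i < L + (d - p)) v n (p + i)%N ^+ 2 + K * Wn n.
  under [X in X + _ <= _]eq_bigr do rewrite sol.
  have := HK L (v n).
  have -> : (L + d = p + (L + (d - p)))%N by rewrite addnCA subnKC.
  rewrite [X in _ <= X + _]big_split_ord /=.
  have : K * \sum_(i < d) bdiff (v n) i ^+ 2 <= K * Wn n.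
    rewrite ler_pM2l // /Wn big_split_ord /= lerDl.
    by apply: sumr_ge0 => i _; exact: sqr_ge0.
  lra.
move=> /(_ step N M); rewrite -!mulr_sumr -/W.
set E := \sum_(i < M) _; set s := \sum_(n < N) v n 0%N ^+ 2 => h.
have Tb : \sum_(n < N) \sum_(i < d + q.+1) v n i ^+ 2
       <= m * (2 * s) + c2 * W.
  rewrite /s /W /c2 !mulr_sumr -big_split /=; apply: ler_sum => n _.
  have -> : m * (2 * v n 0%N ^+ 2) + m * (2 * (d + q)%:R) * Wn n
    = \sum_(i < d + q.+1) (2 * v n 0%N ^+ 2 + 2 * ((d + q)%:R * Wn n)).
    by rewrite sumr_const card_ord -[RHS]mulr_natl -/m; ring.
  apply: ler_sum => i _.
  have i_le : (i <= d + q)%N by rewrite -ltnS -addnS.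
  have := sum_diff_sqr_le (v n) i_le; rewrite -/(Wn n).
  by have := sqrD_le (v n 0%N) (v n i - v n 0%N); rewrite subrKC; lra.
have E0 : 0 <= E by apply: sumr_ge0 => i _; exact: sqr_ge0.
have s0 : 0 <= s by apply: sumr_ge0 => n _; exact: sqr_ge0.
have als : 0 <= al / 4 * s by rewrite mulr_ge0 // divr_ge0 // ltW.
have Eb : E <= B + K * W by lra.
have sb : m * (2 * s) <= m * (8 / al) * (B + K * W).
  rewrite -mulrA ler_wpM2l //.
  have -> : 2 * s = 8 / al * (al / 4 * s) by field; rewrite lt0r_neq0.
  by rewrite ler_wpM2l ?(divr_ge0 _ (ltW al0)) //; lra.
apply: (@le_trans _ _ (c1 * (B + K * W) + c2 * W)).
  by rewrite /c1 mulrDl mul1r; lra.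
have -> : c1 * (B + K * W) + c2 * W = c1 * B + (c1 * K + c2) * W by ring.
have c0 : 0 <= c1 * K + c2 by rewrite addr_ge0 ?mulr_ge0 ?(ltW K0) // (le_trans _ c10).
have := ler_wpM2l c0 Wb => h1.
have h2 : 0 <= c1 * G by rewrite mulr_ge0 // (le_trans _ c10).
have h3 : 0 <= (c1 * K + c2) * Cq * G by rewrite mulr_ge0.
rewrite -subr_ge0.
have -> : (c1 + 4 * ((c1 * K + c2) * Cq)) * (B + G) - (c1 * B + (c1 * K + c2) * W)
 = c1 * G + 3 * ((c1 * K + c2) * Cq * G)
   + ((c1 * K + c2) * (Cq * (4 * B + G)) - (c1 * K + c2) * W) by ring.
lra.
Qed.

(** * From the symbol to the contraction property *)

Lemma cmodE (R : realType) (z : R[i]) : `|z| = (cmod z)%:C.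
Proof. by case: z. Qed.

Lemma cmod_ge0 (R : realType) (z : R[i]) : 0 <= cmod z.
Proof. by case: z => x y; rewrite /cmod /= sqrtr_ge0. Qed.

Lemma sqr_cmod (R : realType) (z : R[i]) : cmod z ^+ 2 = complex.Re z ^+ 2 + complex.Im z ^+ 2.
Proof. by case: z => x y; rewrite /cmod /= sqr_sqrtr ?addr_ge0 ?sqr_ge0. Qed.

Lemma cmodM (R : realType) (z y : R[i]) : cmod (z * y) = cmod z * cmod y.
Proof. exact: ComplexField.Normc.normcM. Qed.

Lemma cmodX (R : realType) (z : R[i]) (n : nat) : cmod (z ^+ n) = cmod z ^+ n.
Proof.
elim: n => [|n IH]; first exact: ComplexField.Normc.normc1.
by rewrite !exprS cmodM IH.
Qed.

Lemma expiD (R : realType) (s t : R) : expi (s + t) = expi s * expi t.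
Proof. by rewrite /expi sinD cosD; simpc; rewrite addrC [X in _ +i* X]addrC. Qed.

Lemma expi0 (R : realType) : expi (0 : R) = 1.
Proof. by rewrite /expi sin0 cos0. Qed.

Lemma expiMn (R : realType) (t : R) (n : nat) : expi (n%:R * t) = expi t ^+ n.
Proof.
elim: n => [|n IH]; first by rewrite mul0r expi0.
by rewrite -natr1 mulrDl mul1r addrC expiD IH exprS.
Qed.

Lemma conjc_expi (R : realType) (t : R) : conjc (expi t) = expi (- t).
Proof. by rewrite /expi /= sinN cosN. Qed.

Lemma expi_conjK (R : realType) (t : R) : expi t * conjc (expi t) = 1.
Proof. by rewrite conjc_expi -expiD subrr expi0. Qed.

Lemma cmod_expi (R : realType) (t : R) : cmod (expi t) = 1.
Proof. by rewrite /cmod /expi /= cos2Dsin2 sqrtr1. Qed.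

Lemma expi_neq1 (R : realType) (t : R) : 0 < t < 2 * pi -> expi t != 1.
Proof.
move=> /andP[t0 t2].
have s0 : 0 < sin (t / 2) by apply: sin_gt0_pi; lra.
apply/eqP => -[] ct _.
have : cos ((t / 2) *+ 2) = 1 by rewrite -mulr_natr divfK.
rewrite cos_mulr2n; have := cos2Dsin2 (t / 2).
have : 0 < sin (t / 2) ^+ 2 by rewrite exprn_gt0.
rewrite -mulr_natr; lra.
Qed.

Lemma expi_prim_root (R : realType) (N : nat) :
  (0 < N)%N -> N.-primitive_root (expi (2 * pi / N%:R : R)).
Proof.
move=> N0; set t := 2 * pi / _.
have NR : 0 < N%:R :> R by rewrite ltr0n.
have wN : expi t ^+ N = 1.
  rewrite -expiMn /t mulrC divfK ?lt0r_neq0 //.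
  by rewrite /expi mulr_natl cos2pi sin2pi.
have [m prim mN] := prim_order_exists N0 wN.
have m_gt0 := prim_order_gt0 prim.
have := dvdn_leq N0 mN; rewrite leq_eqVlt => /predU1P[<- //|m_lt].
have : expi (m%:R * t) != 1.
  apply: expi_neq1; rewrite mulr_gt0 ?ltr0n ?divr_gt0 ?mulr_gt0 ?pi_gt0 //=.
  rewrite /t mulrCA gtr_pMr ?mulr_gt0 ?pi_gt0 // ltr_pdivrMr // mul1r ltr_nat.
  by [].
by rewrite expiMn (prim_expr_order prim) eqxx.
Qed.

Lemma sum_expr_unity (F : fieldType) (N : nat) (z : F) :
  z ^+ N = 1 -> z != 1 -> \sum_(k < N) z ^+ k = 0.
Proof.
move=> zN z1; have := subrX1 z N; rewrite zN subrr => /esym/eqP.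
by rewrite mulf_eq0 subr_eq0 (negPf z1) => /eqP.
Qed.

Definition dft (R : realType) (N : nat) (x : 'I_N -> R) (k : nat) : R[i] :=
  \sum_(i < N) (x i)%:C * expi (2 * pi / N%:R) ^+ (k * i).

Lemma dft_parseval (R : realType) (N : nat) (x : 'I_N -> R) : (0 < N)%N ->
  \sum_(k < N) cmod (dft x k) ^+ 2 = N%:R * \sum_(i < N) x i ^+ 2.
Proof.
move=> N0; apply: (@complexI R).
pose w : R[i] := expi (2 * pi / N%:R).
have prim : N.-primitive_root w by exact: expi_prim_root.
have wN := prim_expr_order prim.
have wc : w * conjc w = 1 by exact: expi_conjK.
have w0 : w != 0.
  by apply/eqP => w0; move: wc; rewrite w0 mul0r => /esym/eqP; rewrite oner_eq0.
have wcN : conjc w ^+ N = 1 by rewrite -rmorphXn wN rmorph1.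
rewrite rmorphM rmorph_nat !rmorph_sum mulr_sumr /=.
transitivity (\sum_(i < N) \sum_(j < N) (x i * x j)%:C *
    \sum_(k < N) (w ^+ i * conjc w ^+ j) ^+ k).
  under [RHS]eq_bigr do under eq_bigr do rewrite mulr_sumr.
  under [RHS]eq_bigr do rewrite exchange_big.
  rewrite exchange_big; apply: eq_bigr => k _ /=.
  rewrite rmorphXn /= -cmodE sqr_normc /dft rmorph_sum mulr_suml /=.
  apply: eq_bigr => i _; rewrite mulr_sumr; apply: eq_bigr => j _.
  rewrite -/w.
  have -> : conjc ((x j)%:C * w ^+ (k * j)) = (x j)%:C * conjc w ^+ (k * j).
    by rewrite rmorphM rmorphXn; congr (_ * _); exact: conjc_real.
  rewrite rmorphM exprMn -!exprM.
  by rewrite [(j * k)%N]mulnC [(i * k)%N]mulnC; ring.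
apply: eq_bigr => i _; rewrite (bigD1 i) //= [X in _ + X]big1 ?addr0.
  rewrite -exprMn wc expr1n.
  under eq_bigr do rewrite expr1n.
  by rewrite sumr_const card_ord mulrC expr2.
move=> j ji; rewrite sum_expr_unity ?mulr0 //.
  by rewrite exprMn -!exprM ![(_ * N)%N]mulnC !exprM wN wcN !expr1n mulr1.
apply/eqP => h.
have : w ^+ i == w ^+ j.
  apply/eqP; rewrite -[LHS]mulr1 -(expr1n _ j) -wc exprMn mulrCA h mulr1.
  by [].
rewrite (eq_prim_root_expr prim) !modn_small // => /eqP/val_inj/esym/eqP.
by rewrite (negPf ji).
Qed.

(** Cyclic shifts are diagonal in the Fourier basis. *)
Lemma dft_shift (R : realType) (n : nat) (x : 'I_n.+1 -> R) (h k : nat) :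
  dft (fun i => x (i + inZp h)) k
  = conjc (expi (2 * pi / n.+1%:R)) ^+ (k * h) * dft x k.
Proof.
set w : R[i] := expi _.
have wc : w * conjc w = 1 by exact: expi_conjK.
have wN : (w ^+ k) ^+ n.+1 = 1.
  by rewrite exprAC (prim_expr_order (expi_prim_root R (ltn0Sn n))) expr1n.
rewrite /dft [in RHS](reindex_inj (addIr (inZp h))) mulr_sumr.
apply: eq_bigr => i _; rewrite -/w.
have -> : w ^+ (k * (i + inZp h)%R) = w ^+ (k * i) * w ^+ (k * h).
  rewrite -exprD -mulnDr /= modnDmr !exprM.
  by rewrite expr_mod.
have : w ^+ (k * h) * conjc w ^+ (k * h) = 1 by rewrite -exprMn wc expr1n.
set A := w ^+ _; set B := conjc w ^+ _ => AB.
by rewrite mulrCA [B * _]mulrCA [B * A]mulrC AB mulr1.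
Qed.

(** On a cycle of length [M + d] the first [M] values of the cyclic convolution
    do not wrap around, so they are those of the stencil; by Parseval the
    cyclic convolution is a contraction as soon as the symbol is bounded by 1
    at the roots of unity. Periodizing a window avoids integrals over the
    circle. *)
Lemma contractive_of_symbol (R : realType) (d : nat) (b : nat -> R) :
  (forall t : R, 0 <= t <= 2 * pi ->
     cmod (\sum_(h < d.+1) (b h)%:C * expi (- (h%:R * t))) <= 1) ->
  window_contractive d b.
Proof.
move=> sym [|M] x.
  by rewrite big_ord0; apply: sumr_ge0 => i _; exact: sqr_ge0.
pose N := (M + d).+1.
pose xN (i : 'I_N) : R := x i.
pose y (i : 'I_N) : R := \sum_(h < d.+1) b h * xN (i + inZp h).
have N0 : 0 < N%:R :> R by rewrite ltr0n.
have dft_le k : (k < N)%N -> cmod (dft y k) ^+ 2 <= cmod (dft xN k) ^+ 2.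
  move=> kN.
  have -> : dft y k = (\sum_(h < d.+1) (b h)%:C
      * expi (- (h%:R * (k%:R * (2 * pi / N%:R))))) * dft xN k.
    rewrite mulr_suml.
    transitivity (\sum_(h < d.+1) (b h)%:C * dft (fun i => xN (i + inZp h)) k).
      rewrite /dft /y.
      under eq_bigr do rewrite rmorph_sum mulr_suml /=.
      rewrite exchange_big; apply: eq_bigr => h _ /=.
      by rewrite mulr_sumr; apply: eq_bigr => i _; rewrite rmorphM /= mulrA.
    apply: eq_bigr => h _; rewrite dft_shift -[RHS]mulrA; congr (_ * (_ * _)).
    by rewrite -conjc_expi !expiMn -exprM rmorphXn.
  rewrite cmodM exprMn.
  rewrite ler_piMl ?sqr_ge0 // expr_le1 ?cmod_ge0 //; apply: sym.
  rewrite mulr_ge0 ?divr_ge0 ?mulr_ge0 ?pi_ge0 //=.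
  by rewrite mulrCA ler_piMr ?mulr_ge0 ?pi_ge0 // ler_pdivrMr // mul1r ler_nat ltnW.
have : N%:R * \sum_(i < N) y i ^+ 2 <= N%:R * \sum_(i < N) xN i ^+ 2.
  by rewrite -!dft_parseval //; apply: ler_sum => k _; exact: dft_le.
rewrite ler_pM2l // => h; apply: (le_trans _ h).
rewrite [leRHS](@big_split_ord _ _ _ M.+1 d) /=.
apply: ler_wpDr; first by apply: sumr_ge0 => i _; exact: sqr_ge0.
rewrite le_eqVlt; apply/predU1P; left.
apply: eq_bigr => i _; congr (_ ^+ 2); apply: eq_bigr => l _.
rewrite /xN /= modnDmr modn_small //.
have := ltn_ord i; have := ltn_ord l; rewrite /N; lia.
Qed.

(** * The scheme seen from the boundary *)

Lemma sum_zrange (V : nmodType) (m n : int) (k : nat) (F : int -> V) :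
  m + k%:Z = n + 1 -> (0 < k)%N ->
  \sum_(l <- zrange m n) F l = \sum_(h < k) F (n - h%:Z).
Proof.
case: k => // k mk _; rewrite /zrange.
have -> : m <= n by lia.
have -> : `|n - m|%N = k by lia.
rewrite big_map -[iota 0 k.+1]/(index_iota 0 k.+1) big_mkord.
rewrite (reindex_inj rev_ord_inj); apply: eq_bigr => i _ /=; congr F.
by have := ltn_ord i; lia.
Qed.

Definition from_right (V : Type) (e : int) (w : int -> V) (i : nat) : V :=
  w (e - i%:Z).

Lemma iter_Dminus (V : zmodType) (e : int) (w : int -> V) (q i : nat) :
  iter q (@Dminus V) w (e - i%:Z) = iter q (@bdiff V) (from_right e w) i.
Proof.
elim: q i => [//|q IH] i; rewrite !iterS /bdiff -!IH /Dminus.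
by have -> : e - i%:Z - 1 = e - i.+1%:Z by lia.
Qed.

Definition reversed_coef (R : Type) (p : nat) (a : int -> R) (h : nat) : R :=
  a (p%:Z - h%:Z).

Lemma sum_stencil (R : pzRingType) (r p : nat) (a w : int -> R) (J : int) (i : nat) :
  \sum_(l <- zrange (- r%:Z) p%:Z) a l * w (J - i%:Z + l)
  = stencil (p + r) (reversed_coef p a) (from_right (J + p%:Z) w) i.
Proof.
rewrite (@sum_zrange _ _ _ (p + r).+1) //; last by lia.
by apply: eq_bigr => h _; congr (_ * w _); lia.
Qed.

(** Reversal of the indices multiplies the symbol by the unimodular factor
    [exp (i p t)]. *)
Lemma stable_contractive (R : realType) (r p : nat) (a : int -> R) :
  l2_stable r p a -> window_contractive (p + r) (reversed_coef p a).
Proof.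
move=> st; apply: contractive_of_symbol => t t2pi.
have : (cmod (\sum_(l <- zrange (- r%:Z) p%:Z) (a l)%:C * expi (l%:~R * t)) <= 1).
  rewrite -lee_fin; apply: le_trans st; apply: ereal_sup_ubound.
  by exists t.
rewrite (@sum_zrange _ _ _ (p + r).+1) //; last by lia.
have -> : \sum_(h < (p + r).+1) (a (p%:Z - h%:Z))%:C * expi ((p%:Z - h%:Z)%:~R * t)
  = expi (p%:R * t) * \sum_(h < (p + r).+1) (reversed_coef p a h)%:C * expi (- (h%:R * t)).
  rewrite mulr_sumr; apply: eq_bigr => h _.
  by rewrite rmorphB /= mulrBl expiD /reversed_coef; ring.
by rewrite cmodM cmod_expi mul1r.
Qed.

Lemma scheme_energy (R : realType) (vel lam : R) (k kb r p : nat) (a : int -> R) :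
  0 < vel -> (1 <= k)%N -> 0 < lam -> a (- r%:Z) * a p%:Z != 0 ->
  consistent r p a vel lam k -> l2_stable r p a ->
  exists2 C : R, 0 < C & finite_time_estimate (p + r) p kb (reversed_coef p a) C.
Proof.
move=> vel0 k1 lam0 ends cons st.
have ar : reversed_coef p a (p + r) != 0.
  have -> : reversed_coef p a (p + r) = a (- r%:Z) by congr a; lia.
  by move: ends; rewrite mulf_eq0 => /norP[].
have cons0 := cons 0%N isT; have cons1 := cons 1%N k1.
rewrite (@sum_zrange _ _ _ (p + r).+1) // in cons0; last by lia.
rewrite (@sum_zrange _ _ _ (p + r).+1) // in cons1; last by lia.
have b1 : \sum_(h < (p + r).+1) reversed_coef p a h = 1.
  by rewrite -[RHS](expr0 (- (lam * vel))) -cons0; apply: eq_bigr => h _; rewrite expr0 mul1r.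
have bal : \sum_(h < (p + r).+1) reversed_coef p a h * ((h : nat)%:R - p%:R) = lam * vel.
  transitivity (- (- (lam * vel)) ^+ 1); last by rewrite expr1 opprK.
  rewrite -cons1 -sumrN; apply: eq_bigr => h _.
  by rewrite expr1 rmorphB /= /reversed_coef; ring.
exact: (energy_estimate (stable_contractive st) ar (leq_addr _ _) (mulr_gt0 lam0 vel0) b1 bal).
Qed.

Lemma solution_solves (R : realType) (r p kb : nat) (a : int -> R) (J : int) f g u :
  is_solution r p a kb J f g u ->
  solves (p + r) p (reversed_coef p a) (fun n => from_right (J + p%:Z) (u n)).
Proof.
case=> _ _ scheme n i; rewrite -sum_stencil -scheme /from_right; last by lia.
by congr (u _ _); lia.
Qed.

(** * Exponential weights and series *)

(** Summation by parts: decreasing weights turn nonnegative partial sums into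
    nonnegative weighted partial sums. *)
Lemma abel_weighted (R : realFieldType) (B : R) (w X : nat -> R) :
  (forall n, 0 <= w n.+1 <= w n) ->
  (forall N, 0 <= B + \sum_(n < N) X n) ->
  forall N, 0 <= w 0%N * B + \sum_(n < N) w n * X n.
Proof.
move=> wm S0 N.
have w0 n : 0 <= w n by have /andP[] := wm n; exact: le_trans.
have : w N * (B + \sum_(n < N) X n) <= w 0%N * B + \sum_(n < N) w n * X n.
  elim: N => [|N IH]; first by rewrite !big_ord0 !addr0.
  rewrite [X in _ <= _ + X]big_ord_recr /=; have /andP[_ wN] := wm N.
  have := ler_wpM2r (S0 N.+1) wN; rewrite big_ord_recr /=; lra.
by apply: le_trans; rewrite mulr_ge0.
Qed.

(** The traces are weighted by [abel_weighted]; for the final energy it is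
    enough that the last weight is the smallest one. *)
Lemma weighted_estimate (R : realType) (d p q : nat) (b w : nat -> R) (C B : R)
    (v : nat -> nat -> R) :
  finite_time_estimate d p q b C -> 0 < C ->
  w 0%N = 1 -> (forall n, 0 <= w n.+1 <= w n) ->
  solves d p b v ->
  (forall M, \sum_(i < M) v 0%N (p + i)%N ^+ 2 <= B) ->
  forall N,
    (forall M, w N * \sum_(i < M) v N (p + i)%N ^+ 2
      <= C * (B + \sum_(n < N) w n * \sum_(i < p) iter q (@bdiff R) (v n) i ^+ 2)) /\
    \sum_(n < N) w n * \sum_(i < d + q) v n i ^+ 2
      <= C * (B + \sum_(n < N) w n * \sum_(i < p) iter q (@bdiff R) (v n) i ^+ 2).
Proof.
move=> est C0 w0 wm sol vB N.
set G := fun n => \sum_(i < p) iter q (@bdiff R) (v n) i ^+ 2.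
set T := fun n => \sum_(i < d + q) v n i ^+ 2.
have B0 : 0 <= B by have := vB 0%N; rewrite big_ord0.
have G0 n : 0 <= G n by apply: sumr_ge0 => i _; exact: sqr_ge0.
have T0 n : 0 <= T n by apply: sumr_ge0 => i _; exact: sqr_ge0.
have wn0 n : 0 <= w n by have /andP[] := wm n; exact: le_trans.
have wle m n : (m <= n)%N -> w n <= w m.
  elim: n => [|n IH]; first by rewrite leqn0 => /eqP ->.
  rewrite leq_eqVlt => /predU1P[-> //|mn].
  by have /andP[_ h] := wm n; apply: (le_trans h); exact: IH.
split=> [M|].
  have h := est _ _ sol vB N M.
  have {}h : \sum_(i < M) v N (p + i)%N ^+ 2 <= C * (B + \sum_(n < N) G n).
    by apply: le_trans h; rewrite lerDl; apply: sumr_ge0 => n _; exact: T0.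
  have {}h := ler_wpM2l (wn0 N) h; apply: (le_trans h).
  rewrite mulrCA ler_pM2l // mulrDr; apply: lerD.
    by apply: ler_piMl => //; rewrite -w0 wle.
  by rewrite mulr_sumr; apply: ler_sum => n _; rewrite ler_wpM2r // wle // ltnW.
have pos K : 0 <= C * B + \sum_(n < K) (C * G n - T n).
  have h := est _ _ sol vB K 0%N; rewrite big_ord0 add0r in h.
  by rewrite sumrB -mulr_sumr addrA -mulrDr subr_ge0.
have := @abel_weighted _ _ _ (fun n => C * G n - T n) wm pos N; rewrite w0 mul1r.
under eq_bigr do rewrite mulrBr mulrCA.
by rewrite sumrB -mulr_sumr addrA -mulrDr subr_ge0.
Qed.

Lemma esum_half_line (R : realType) (J : int) (F : int -> \bar R) :
  (forall j, (0 <= F j)%E) ->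
  (\esum_(j in [set j : int | (j <= J)%R]) F j
   = \sum_(0 <= i <oo) F (J - i%:Z)%R)%classic%E.
Proof.
move=> F0; rewrite nneseries_esumT //.
apply: (@reindex_esum _ _ _ setT _ (fun i : nat => J - i%:Z)).
split=> [i _ /=|i i' _ _ /=|j /= jJ]; first by lia.
  by lia.
by exists `|J - j|%N => //; lia.
Qed.

Lemma sum_le_nneseries (R : realType) (F : nat -> R) (M : nat) :
  (forall i, 0 <= F i) ->
  ((\sum_(i < M) F i)%:E <= \sum_(0 <= i <oo) (F i)%:E)%E.
Proof.
move=> F0; rewrite -sumEFin -(big_mkord xpredT (fun i => (F i)%:E)).
by apply: nneseries_lim_ge => i _ _; rewrite lee_fin.
Qed.

Lemma nneseries_le_sum (R : realType) (F : nat -> R) (B : R) :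
  (forall i, 0 <= F i) -> (forall M, \sum_(i < M) F i <= B) ->
  (\sum_(0 <= i <oo) (F i)%:E <= B%:E)%E.
Proof.
move=> F0 FB; apply: lime_le.
  by apply: is_cvg_nneseries => i _ _; rewrite lee_fin.
by apply: nearW => M; rewrite big_mkord sumEFin lee_fin.
Qed.

Lemma nneseries_fin_bound (R : realType) (F : nat -> R) :
  (forall i, 0 <= F i) -> (\sum_(0 <= i <oo) (F i)%:E < +oo)%E ->
  exists2 B : R, (\sum_(0 <= i <oo) (F i)%:E = B%:E)%E
    & forall M, \sum_(i < M) F i <= B.
Proof.
move=> F0 fin.
have ge0 : (0 <= \sum_(0 <= i <oo) (F i)%:E)%E.
  by apply: nneseries_ge0 => i _ _; rewrite lee_fin.
exists (fine (\sum_(0 <= i <oo) (F i)%:E)%E).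
  by rewrite fineK // ge0_fin_numE.
move=> M; rewrite -lee_fin fineK ?ge0_fin_numE //.
exact: sum_le_nneseries.
Qed.

(** In the constant, the ratio of [dt] to [dx] appears because the energies
    at fixed time are measured with [dx] and the traces with [dt]. *)
Lemma stability_estimate (R : realType) (lam : R) (r p kb : nat) (a : int -> R) (C : R) :
  (0 < p)%N -> 0 < lam -> 0 < C ->
  finite_time_estimate (p + r) p kb (reversed_coef p a) C ->
  forall (J : int) (f : int -> R) (g u : nat -> int -> R),
  square_summable J f -> is_solution r p a kb J f g u ->
  forall gam dt dx : R, 0 < gam -> dt / dx = lam -> 0 < dt ->
  (interior_term J gam dt dx u + trace_term r p kb J gam dt u
    <= (C * (2 + lam + lam^-1))%:E *
       (initial_term J dx f + source_term p J gam dt g))%E.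
Proof.
move=> p0 lam0 C0 est J f g u f2 sol gam dt dx gam0 dtdx dt0.
have dx0 : 0 < dx.
  by rewrite -invr_gt0 -(pmulr_rgt0 _ dt0) dtdx.
have dtE : dt = lam * dx by rewrite -dtdx divfK // lt0r_neq0.
pose v n := from_right (J + p%:Z) (u n).
have solv : solves (p + r) p (reversed_coef p a) v := solution_solves sol.
have [u0 ug _] := sol.
pose w n := expR (- (2 * gam * n%:R * dt)).
have w0 : w 0%N = 1 by rewrite /w mulr0 mul0r oppr0 expR0.
have wm n : 0 <= w n.+1 <= w n.
  rewrite expR_ge0 ler_expR lerN2 ler_pM2r // ler_pM2l ?mulr_gt0 //.
  by rewrite ler_nat leqnSn.
have wp n : 0 < w n by exact: expR_gt0.
have f2' : (\sum_(0 <= i <oo) (f (J - i%:Z) ^+ 2)%:E < +oo)%E.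
  by move: f2; rewrite /square_summable esum_half_line // => j; rewrite lee_fin sqr_ge0.
have [B fB B_ge] := nneseries_fin_bound (fun i => sqr_ge0 (f (J - i%:Z))) f2'.
have vpE n i : v n (p + i)%N = u n (J - i%:Z).
  by rewrite /v /from_right; congr (u _ _); lia.
have vB M : \sum_(i < M) v 0%N (p + i)%N ^+ 2 <= B.
  apply: le_trans (B_ge M); apply: ler_sum => i _.
  by rewrite vpE u0 //; lia.
have B0 : 0 <= B by have := vB 0%N; rewrite big_ord0.
have -> : initial_term J dx f = (dx * B)%:E.
  rewrite /initial_term esum_half_line; last first.
    by move=> j; rewrite lee_fin mulr_ge0 ?sqr_ge0 // ltW.
  under eq_eseriesr do rewrite EFinM.
  by rewrite nneseriesZl ?fB // => i _; rewrite lee_fin sqr_ge0.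
pose G n := \sum_(i < p) iter kb (@bdiff R) (v n) i ^+ 2.
have G0 n : 0 <= G n by apply: sumr_ge0 => i _; exact: sqr_ge0.
have srcE : source_term p J gam dt g
    = (\sum_(0 <= n <oo) (dt * w n * G n)%:E)%E.
  apply: eq_eseriesr => n _; congr (_ * _)%:E.
  rewrite (@sum_zrange _ _ _ p) //; last by lia.
  apply: eq_bigr => i _; rewrite -iter_Dminus -ug; last by have := ltn_ord i; lia.
  by rewrite addrA.
have srcF0 n : 0 <= dt * w n * G n by rewrite mulr_ge0 // mulr_ge0 // ltW.
have traceE : trace_term r p kb J gam dt u
    = (\sum_(0 <= n <oo) (dt * w n * \sum_(i < p + r + kb) v n i ^+ 2)%:E)%E.
  apply: eq_eseriesr => n _; congr (_ * _)%:E.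
  rewrite (@sum_zrange _ _ _ (p + r + kb)); [|lia|lia].
  by apply: eq_bigr => i _; rewrite /v /from_right addrA.
have K0 : 0 < C * (2 + lam + lam^-1).
  by rewrite mulr_gt0 // !addr_gt0 // invr_gt0.
have [srcfin|] := ltP (source_term p J gam dt g) +oo%E; last first.
  rewrite leye_eq => /eqP ->.
  by rewrite addey // gt0_muley ?lte_fin // leey.
rewrite srcE in srcfin *.
have [s -> s_ge] := nneseries_fin_bound srcF0 srcfin.
rewrite -EFinD -EFinM.
have sum_s N : \sum_(n < N) w n * G n <= s / dt.
  rewrite ler_pdivlMr // mulrC mulr_sumr; apply: le_trans (s_ge N).
  by apply: ler_sum => n _; rewrite mulrA.
have s0 : 0 <= s by have := s_ge 0%N; rewrite big_ord0.
have est' := weighted_estimate est C0 w0 wm solv vB.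
have bound N : C * (B + \sum_(n < N) w n * G n) <= C * (B + s / dt).
  by rewrite ler_pM2l // lerD2l.
have intb : (interior_term J gam dt dx u <= (dx * (C * (B + s / dt)))%:E)%E.
  apply: ge_ereal_sup => _ [n _ <-]; rewrite esum_half_line; last first.
    by move=> j; rewrite lee_fin mulr_ge0 ?sqr_ge0 // ltW.
  have h : (\sum_(0 <= i <oo) (dx * u n (J - i%:Z) ^+ 2)%:E
      <= (dx * (C * (B + s / dt)) / w n)%:E)%E.
    apply: nneseries_le_sum => [i|M].
      by rewrite mulr_ge0 ?sqr_ge0 // ltW.
    rewrite -mulr_sumr -mulrA ler_pM2l // ler_pdivlMr // mulrC.
    have [h _] := est' n; apply: le_trans (bound n).
    apply: le_trans (h M); rewrite ler_pM2l //.
    by apply: ler_sum => i _; rewrite vpE.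
  apply: (le_trans (lee_wpmul2l _ h)); first by rewrite lee_fin expR_ge0.
  by rewrite -EFinM lee_fin mulrC divfK // lt0r_neq0.
have trb : (trace_term r p kb J gam dt u <= (dt * (C * (B + s / dt)))%:E)%E.
  rewrite traceE; apply: nneseries_le_sum => [n|N].
    rewrite !mulr_ge0 ?(ltW dt0) ?(ltW (wp n)) //.
    by apply: sumr_ge0 => i _; exact: sqr_ge0.
  have [_ h] := est' N.
  have -> : \sum_(n < N) dt * w n * (\sum_(i < p + r + kb) v n i ^+ 2)
          = dt * \sum_(n < N) w n * (\sum_(i < p + r + kb) v n i ^+ 2).
    by rewrite mulr_sumr; apply: eq_bigr => n _; rewrite mulrA.
  by rewrite ler_pM2l //; apply: (le_trans h).
apply: (le_trans (leeD intb trb)); rewrite -EFinD lee_fin.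
rewrite -mulrDl [leLHS]mulrCA -mulrA ler_pM2l //.
have -> : (dx + dt) * (B + s / dt) = (1 + lam) * (dx * B) + (1 + lam^-1) * s.
  by rewrite dtE; field; rewrite !lt0r_neq0.
have h1 : 0 <= dx * B by rewrite mulr_ge0 // ltW.
have h2 : 0 <= lam^-1 * (dx * B) by rewrite mulr_ge0 // invr_ge0 ltW.
have h3 : 0 <= lam * s by rewrite mulr_ge0 // ltW.
lra.
Qed.

(** * The Uniform Kreiss Lopatinskii Condition *)

Lemma Re_sum (R : realType) (n : nat) (F : 'I_n -> R[i]) :
  complex.Re (\sum_(i < n) F i) = \sum_(i < n) complex.Re (F i).
Proof. by apply: big_morph => // -[? ?] [? ?]. Qed.

Lemma Im_sum (R : realType) (n : nat) (F : 'I_n -> R[i]) :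
  complex.Im (\sum_(i < n) F i) = \sum_(i < n) complex.Im (F i).
Proof. by apply: big_morph => // -[? ?] [? ?]. Qed.

Lemma iter_diff_morph (U V : zmodType) (f : U -> V) (q : nat) (x : nat -> U) (i : nat) :
  {morph f : y z / y - z} ->
  iter q (@bdiff V) (f \o x) i = f (iter q (@bdiff U) x i).
Proof. by move=> fB; elim: q i => [//|q IH] i; rewrite !iterS /bdiff !IH fB. Qed.

(** The coefficients are real, so real and imaginary parts are solutions. *)
Lemma energy_estimate_complex (R : realType) (d p q : nat) (b : nat -> R) (C : R) :
  finite_time_estimate d p q b C ->
  forall (v : nat -> nat -> R[i]) (B : R),
    solves d p (fun h => (b h)%:C) v ->
    (forall M, \sum_(i < M) cmod (v 0%N (p + i)%N) ^+ 2 <= B) ->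
    forall N,
      \sum_(n < N) \sum_(i < d + q) cmod (v n i) ^+ 2
      <= C * (2 * B + \sum_(n < N) \sum_(i < p) cmod (iter q (@bdiff R[i]) (v n) i) ^+ 2).
Proof.
move=> H v B sol vB N.
have HR := H (fun n => @complex.Re R \o v n) B _ _ N 0%N.
have HI := H (fun n => @complex.Im R \o v n) B _ _ N 0%N.
have solR : solves d p b (fun n => @complex.Re R \o v n).
  move=> n i /=; rewrite sol /stencil Re_sum; apply: eq_bigr => h _ /=.
  by case: (v n (i + h)%N) => x y; simpc.
have solI : solves d p b (fun n => @complex.Im R \o v n).
  move=> n i /=; rewrite sol /stencil Im_sum; apply: eq_bigr => h _ /=.
  by case: (v n (i + h)%N) => x y; simpc.
have vBR M : \sum_(i < M) (@complex.Re R \o v 0%N) (p + i)%N ^+ 2 <= B.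
  apply: le_trans (vB M); apply: ler_sum => i _.
  by rewrite sqr_cmod lerDl sqr_ge0.
have vBI M : \sum_(i < M) (@complex.Im R \o v 0%N) (p + i)%N ^+ 2 <= B.
  apply: le_trans (vB M); apply: ler_sum => i _.
  by rewrite sqr_cmod lerDr sqr_ge0.
have split_sum (m : nat) (x : nat -> nat -> R[i]) :
    \sum_(n < N) \sum_(i < m) cmod (x n i) ^+ 2
    = \sum_(n < N) \sum_(i < m) complex.Re (x n i) ^+ 2 + \sum_(n < N) \sum_(i < m) complex.Im (x n i) ^+ 2.
  rewrite -big_split; apply: eq_bigr => n _ /=; rewrite -big_split.
  by apply: eq_bigr => i _; rewrite sqr_cmod.
have ReB : {morph @complex.Re R : y z / y - z} by move=> [? ?] [? ?].
have ImB : {morph @complex.Im R : y z / y - z} by move=> [? ?] [? ?].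
have eR : \sum_(n < N) \sum_(i < p) iter q (@bdiff R) (@complex.Re R \o v n) i ^+ 2
        = \sum_(n < N) \sum_(i < p) complex.Re (iter q (@bdiff R[i]) (v n) i) ^+ 2.
  by apply: eq_bigr => n _; apply: eq_bigr => i _; rewrite (iter_diff_morph _ _ _ ReB).
have eI : \sum_(n < N) \sum_(i < p) iter q (@bdiff R) (@complex.Im R \o v n) i ^+ 2
        = \sum_(n < N) \sum_(i < p) complex.Im (iter q (@bdiff R[i]) (v n) i) ^+ 2.
  by apply: eq_bigr => n _; apply: eq_bigr => i _; rewrite (iter_diff_morph _ _ _ ImB).
rewrite (split_sum _ v) (split_sum _ (fun n => iter q (@bdiff R[i]) (v n))) -eR -eI; have := lerD (HR solR vBR) (HI solI vBI).
rewrite !big_ord0 !add0r /= -mulrDr => h; apply: (le_trans h).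
by rewrite le_eqVlt; apply/predU1P; left; congr (_ * _); ring.
Qed.

(** The weights have infinite total mass, so the fixed term [B] disappears
    from the average. *)
Lemma geometric_average (R : archiRealFieldType) (x y B zeta : R) :
  1 <= zeta ->
  (forall N, \sum_(n < N) zeta ^+ n * x <= B + \sum_(n < N) zeta ^+ n * y) ->
  x <= y.
Proof.
move=> z1 H; rewrite leNgt; apply/negP => yx.
have d0 : 0 < x - y by rewrite subr_gt0.
have B0 : 0 <= B by have := H 0%N; rewrite !big_ord0 addr0.
set N := Num.bound (B / (x - y)).
have BN : B < N%:R * (x - y).
  by rewrite -ltr_pdivrMr //; apply: archi_boundP; rewrite divr_ge0 // ltW.
have := H N; rewrite -!mulr_suml.
have : N%:R <= \sum_(n < N) zeta ^+ n.
  rewrite -[N in leLHS]card_ord -sumr_const.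
  by apply: ler_sum => n _; rewrite exprn_ege1.
set Z := \sum_(n < N) _ => NZ.
have := ler_wpM2r (ltW d0) NZ; lra.
Qed.

(** [z^n * w] is a solution with boundary data [z^n * D^kb w]; its traces and
    its data all grow like [|z|^n], while its initial energy is fixed. *)
Lemma finite_time_UKLC (R : realType) (r p kb : nat) (a : int -> R) (C : R) :
  (0 < p)%N -> 0 < C ->
  finite_time_estimate (p + r) p kb (reversed_coef p a) C ->
  UKLC r p a kb.
Proof.
move=> p0 C0 est rho _; exists C => // J _ z /andP[z1 _] w w2 scheme.
pose e := J%:Z + p%:Z.
pose v n i := z ^+ n * from_right e w i.
have solv : solves (p + r) p (fun h => (reversed_coef p a h)%:C) v.
  move=> n i; rewrite /v exprSr -mulrA.
  have -> : from_right e w (p + i) = w (J%:Z - i%:Z) by congr w; rewrite /e; lia.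
  rewrite scheme; last by lia.
  rewrite (sum_stencil r p (fun l => (a l)%:C) w) /stencil mulr_sumr.
  by apply: eq_bigr => h _; rewrite mulrCA.
have w2' : (\sum_(0 <= i <oo) (cmod (from_right e w i) ^+ 2)%:E < +oo)%E.
  by move: w2; rewrite /square_summableC esum_half_line // => j; rewrite lee_fin sqr_ge0.
have [B _ B_ge] := nneseries_fin_bound (fun i => sqr_ge0 (cmod (from_right e w i))) w2'.
have vB M : \sum_(i < M) cmod (v 0%N (p + i)%N) ^+ 2 <= B.
  apply: le_trans (B_ge (p + M)%N); rewrite big_split_ord /=.
  apply: ler_wpDl; first by apply: sumr_ge0 => i _; exact: sqr_ge0.
  by apply: ler_sum => i _; rewrite /v expr0 mul1r.
have H := energy_estimate_complex est solv vB.
have -> : \sum_(l <- zrange 1 p%:Z) cmod (iter kb (@Dminus R[i]) w (J%:Z + l)) ^+ 2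
  = \sum_(i < p) cmod (iter kb (@bdiff R[i]) (from_right e w) i) ^+ 2.
  rewrite (@sum_zrange _ _ _ p) //; last by lia.
  by apply: eq_bigr => i _; rewrite -iter_Dminus addrA.
apply: (@le_trans _ _ (\sum_(i < p + r + kb) cmod (from_right e w i) ^+ 2)).
  rewrite (@sum_zrange _ _ _ (p + r)%N) ?addn_gt0 ?p0 //; last by lia.
  rewrite [leRHS]big_split_ord /=; apply: ler_wpDr.
    by apply: sumr_ge0 => i _; exact: sqr_ge0.
  by apply: ler_sum => i _; rewrite addrA.
apply: (@geometric_average _ _ _ (C * (2 * B)) (cmod z ^+ 2)).
  by rewrite expr_ge1 ?cmod_ge0 // ltW.
move=> N; have := H N.
have pull n m (x : nat -> R[i]) : \sum_(i < m) cmod (z ^+ n * x i) ^+ 2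
    = cmod z ^+ 2 ^+ n * \sum_(i < m) cmod (x i) ^+ 2.
  rewrite mulr_sumr; apply: eq_bigr => i _.
  by rewrite cmodM exprMn cmodX exprAC.
have -> : \sum_(n < N) \sum_(i < p + r + kb) cmod (v n i) ^+ 2
  = \sum_(n < N) cmod z ^+ 2 ^+ n * \sum_(i < p + r + kb) cmod (from_right e w i) ^+ 2.
  by apply: eq_bigr => n _; rewrite -pull.
have -> : \sum_(n < N) \sum_(i < p) cmod (iter kb (@bdiff R[i]) (v n) i) ^+ 2
  = \sum_(n < N) cmod z ^+ 2 ^+ n *
      \sum_(i < p) cmod (iter kb (@bdiff R[i]) (from_right e w) i) ^+ 2.
  apply: eq_bigr => n _; rewrite -pull; apply: eq_bigr => i _.
  rewrite -(@iter_diff_morph _ _ (fun y => z ^+ n * y)) // => y y'.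
  by rewrite mulrBr.
move=> h; apply: (le_trans h); rewrite mulrDr lerD2l mulr_sumr.
by apply: ler_sum => n _; rewrite mulrCA.
Qed.

(** * Stability of the scheme *)

Theorem theorem3p1 (R : realType) (vel lam : R) (k kb r p : nat) (a : int -> R)
    (vel_gt0 : 0 < vel) (k_ge1 : (1 <= k)%N) (lam_gt0 : 0 < lam)
    (r_ge1 : (1 <= r)%N) (p_ge1 : (1 <= p)%N)
    (a_ends : a (- r%:Z) * a p%:Z != 0)
    (a_consistent : consistent r p a vel lam k)
    (a_stable : l2_stable r p a) :
  (exists2 C : R, 0 < C &
     forall J : nat, (0 < J)%N ->
     forall (f : int -> R) (g : nat -> int -> R),
       square_summable J%:Z f ->
       growth_condition p J%:Z g ->
     forall u : nat -> int -> R,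
       is_solution r p a kb J%:Z f g u ->
     forall gam dt dx : R,
       0 < gam -> dt / dx = lam -> 0 < dt <= 1 ->
       (interior_term J%:Z gam dt dx u + trace_term r p kb J%:Z gam dt u <=
        C%:E * (initial_term J%:Z dx f + source_term p J%:Z gam dt g))%E)
  /\ UKLC r p a kb.
Proof.
have [C C0 est] := scheme_energy kb vel_gt0 k_ge1 lam_gt0 a_ends a_consistent a_stable.
split; last exact: (finite_time_UKLC p_ge1 C0 est).
exists (C * (2 + lam + lam^-1)).
  by rewrite mulr_gt0 // !addr_gt0 // invr_gt0.
move=> J _ f g f2 _ u sol gam dt dx gam0 dtdx /andP[dt0 _].
exact: (stability_estimate p_ge1 lam_gt0 C0 est f2 sol gam0 dtdx dt0).
Qed.
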